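(* As $n\to\infty$ through odd integers, $\beta(F_n)=(2+o(1))\,n/\log_2 n$. As $n\to\infty$ through even integers, $(2+o(1))\,n/\log_2 n\le \beta(F_n)\le (4+o(1))\,n/\log_2 n$.
   Context: For $u\in\{0,1\}^n$, $\overline{u}=u+(1,\dots,1)\pmod 2$. The folded hypercube $F_n$ has vertex set $\{\{u,\overline{u}\}:u\in\{0,1\}^n\}$, with $\{u,\overline u\}$ adjacent to $\{v,\overline v\}$ iff $u$ and $v$, or $u$ and $\overline v$, differ in exactly one coordinate. For a graph $G$, a set $S\subseteq V(G)$ is resolving if for all distinct $u,v$ some $y\in S$ has $d_G(u,y)\neq d_G(v,y)$, and $\beta(G)$ is the minimum size of a resolving set. *)

(* Defs.v *)
From HB Require Import structures.
From mathcomp Require Import all_boot all_order all_algebra.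
From mathcomp Require Import reals exp.

Set Implicit Arguments.
Unset Strict Implicit.
Unset Printing Implicit Defensive.

Import Order.TTheory GRing.Theory Num.Theory.

Definition walk_of_length (T : finType) (e : rel T) (k : nat) (x y : T) : bool :=
  [exists p : k.-tuple T, path e x p && (last x p == y)].

(* When x and y lie in one connected component a shortest walk has fewer than *)
(* #|T| edges; otherwise the value is #|T|, which plays the role of infinity. *)
Definition dist (T : finType) (e : rel T) (x y : T) : nat :=
  find (fun k => walk_of_length e k x y) (iota 0 #|T|).

Definition resolving (T : finType) (e : rel T) (S : {set T}) : bool :=
  [forall u, forall v,
    (u != v) ==> [exists y in S, dist e u y != dist e v y]].

(* The default value [set: T] of the arg min is itself resolving, since       *)
(* dist e u y = 0 only for u = y.                                             *)
Definition metric_dim (T : finType) (e : rel T) : nat :=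
  #|[arg min_(S < [set: T] | resolving e S) #|S|]|.

Definition cube (n : nat) : finType := {ffun 'I_n -> bool}.

Definition antipode (n : nat) (u : cube n) : cube n :=
  [ffun i => u i (+) true].

Definition hamming (n : nat) (u v : cube n) : nat := #|[set i | u i != v i]|.

Definition folded_vertex (n : nat) : finType :=
  {A : {set cube n} | [exists u : cube n, A == [set u; antipode u]]}.

(* For n = 1 the single vertex is adjacent to itself; loops do not affect dist. *)
Definition folded_adj (n : nat) : rel (folded_vertex n) := fun A B =>
  [exists u : cube n, exists v : cube n,
    [&& val A == [set u; antipode u], val B == [set v; antipode v]
      & (hamming u v == 1) || (hamming u (antipode v) == 1)]].

Definition beta_folded (n : nat) : nat := metric_dim (@folded_adj n).

Definition log2 (R : realType) (x : R) : R := (ln x / ln 2)%R.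

(* Main.v *)
Require Import Defs.
From mathcomp Require Import all_boot all_order all_algebra.
From mathcomp Require Import zify ring lra.
From mathcomp Require Import all_classical all_reals all_analysis.
Import Order.TTheory GRing.Theory Num.Theory.
Import numFieldNormedType.Exports.

Set Implicit Arguments.
Unset Strict Implicit.
Unset Printing Implicit Defensive.

(* The distance of {u, ~u} and {v, ~v} in F_n is min(h, n - h) for the Hamming   *)
(* distance h of u and v.                                                        *)
(*                                                                               *)
(* Lower bound. Let y_1, ..., y_k resolve F_n, let s ^ 2 >= n, and put           *)
(* a_j(u) = |n - 2 h(u, y_j)|. The second moment of n - 2 h over the cube is n,  *)
(* so each a_j has mean at most s, and X = \sum_j floor(a_j / s) has mean at     *)
(* most k; by convexity 2 ^ - X has mean at least 2 ^ - k. On the other hand     *)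
(* u |-> (a_j(u))_j is at most two-to-one, so the sum of 2 ^ - X over the cube   *)
(* is at most 2 (\sum_a 2 ^ - floor(a / s)) ^ k <= 2 (2 s) ^ k. Hence            *)
(* 2 ^ n <= 2 (4 s) ^ k with s of order sqrt n.                                  *)
(*                                                                               *)
(* Upper bound. A 0/1 matrix with m rows and n columns that determines every     *)
(* x in {0,1}^n from its m row sums gives m + 1 vertices resolving the cube Q_n. *)
(* Doubling (m, n) to (2 m + 1, 2 n + m), starting with (1, 1), yields matrices  *)
(* of size (2 ^ (k+1) - 1, k 2 ^ k + 1); block diagonal copies of one of them    *)
(* cover all n with m = (2 + o(1)) n / log2 n. A resolving set of Q_n resolves   *)
(* F_n when n is odd, and twice as many vertices suffice for every n.            *)

(** * Distances in the folded hypercube *)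

(** Distances to one vertex mostly vary over a window of width of order [sqrt n], so each vertex of
    a resolving set reveals about [(log2 n) / 2] bits of the [n - 1] that are needed. This heuristic
    gives the constant 2, and [fold_resolving_card] makes it rigorous. Detecting matrices
    ([detectable_expn]) reach the same rate. [odd_fold_resolving] transfers them to [F_n] without
    loss for odd [n]; for even [n], [pair_fold_resolving] doubles the number of vertices, whence 4.
    [beta_folded_lower] and [block_bound] carry the bounds in integers with relative error of order
    [1 / r], where [r] is the integer square root of [trunc_log 2 n], and [beta_ratio_near] turns
    them into limits. *)

Section Distance.
Variables (T : finType) (e : rel T).

Lemma walk_of_length0 x y : walk_of_length e 0 x y = (x == y).
Proof.
apply/existsP/eqP => [[p]|->]; first by rewrite (tuple0 p) /= => /eqP.
by exists [tuple]; rewrite /= eqxx.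
Qed.

Lemma walk_of_lengthS k x y :
  walk_of_length e k.+1 x y = [exists z, e x z && walk_of_length e k z y].
Proof.
apply/existsP/existsP => [[p]|[z /andP[exz /existsP[p /andP[ep ly]]]]].
  case: (tupleP p) => z q /= /andP[/andP[exz eq] ly].
  by exists z; rewrite exz; apply/existsP; exists q; rewrite eq.
by exists [tuple of z :: p]; rewrite /= exz ep.
Qed.

(** The second hypothesis makes every walk from [x] to [z] at least [D x z] long; the third,
    iterated, builds a walk of exactly that length. *)
Lemma dist_eq (D : T -> T -> nat) :
    (forall x y, (D x y == 0) = (x == y)) ->
    (forall x y z, e x y -> D x z <= (D y z).+1) ->
    (forall x z, 0 < D x z -> exists2 y, e x y & D x z = (D y z).+1) ->
  forall x z, dist e x z = D x z.
Proof.
move=> D0 Dle Dstep x z.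
have walk_ge k y : walk_of_length e k y z -> D y z <= k.
  elim: k y => [|k IHk] y; first by rewrite walk_of_length0 -D0 leqn0.
  rewrite walk_of_lengthS => /existsP[w /andP[eyw /IHk Dw]].
  exact: leq_trans (Dle _ _ _ eyw) _.
have walk_D y : walk_of_length e (D y z) y z.
  move Ek: (D y z) => k; elim: k y Ek => [|k IHk] y Ek.
    by rewrite walk_of_length0 -D0 Ek.
  have [|w eyw Ew] := Dstep y z; first by rewrite Ek.
  rewrite walk_of_lengthS; apply/existsP; exists w; rewrite eyw IHk //.
  by move: Ew; rewrite Ek => -[].
(* [dist] searches only lengths below [#|T|]; a descending walk meets all values [0, ..., D x z], so
   there are more than [D x z] vertices. *)
have DltT : D x z < #|T|.
  have sub j y : j <= D y z -> exists w, D w z = j.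
    move Ek: (D y z) => k; elim: k y Ek => [|k IHk] y Ek.
      by rewrite leqn0 => /eqP->; exists y.
    rewrite leq_eqVlt => /orP[/eqP->|ltjk]; first by exists y.
    have [|w eyw Ew] := Dstep y z; first by rewrite Ek.
    by apply: (IHk w) => //; move: Ew; rewrite Ek => -[].
  have : {subset iota 0 (D x z).+1 <= codom (D^~ z)}.
    by move=> j; rewrite mem_iota add0n ltnS => /sub[w <-]; apply: codom_f.
  by move/(uniq_leq_size (iota_uniq _ _)); rewrite size_iota size_codom.
rewrite /dist; set P := fun k => _; set s := iota _ _.
have nthS k : k < #|T| -> nth 0 s k = k by move=> ?; rewrite nth_iota ?add0n.
have [lt|gt|//] := ltngtP (find P s) (D x z).
  have lt' : find P s < #|T| := ltn_trans lt DltT.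
  have hasP : has P s by rewrite has_find size_iota.
  by have := nth_find 0 hasP; rewrite nthS // => /walk_ge; rewrite leqNgt lt.
by have := before_find 0 gt; rewrite nthS // /P walk_D.
Qed.

Lemma dist_eq0 x y : (dist e x y == 0) = (x == y).
Proof.
rewrite /dist; have : 0 < #|T| by apply/card_gt0P; exists x.
case: #|T| => // m _ /=; rewrite walk_of_length0.
by case: (x == y).
Qed.

Lemma resolving_setT : resolving e [set: T].
Proof.
apply/forallP => u; apply/forallP => v; apply/implyP => neq_uv.
apply/existsP; exists u; rewrite inE /=.
by rewrite (eqP (_ : dist e u u == 0)) ?dist_eq0 // eq_sym dist_eq0 eq_sym.
Qed.

Lemma metric_dim_le S : resolving e S -> metric_dim e <= #|S|.
Proof.
by rewrite /metric_dim; case: arg_minnP => [|A _ minA /minA//]; apply: resolving_setT.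
Qed.

Lemma metric_dim_witness : exists2 S, resolving e S & #|S| = metric_dim e.
Proof.
by rewrite /metric_dim; case: arg_minnP => [|A ? _]; [apply: resolving_setT | exists A].
Qed.

End Distance.

(** * Hamming distance and antipodal classes *)

Section Hamming.
Variable n : nat.
Implicit Types u v w : cube n.

Lemma antipodeK : involutive (@antipode n).
Proof. by move=> u; apply/ffunP => i; rewrite !ffunE; case: (u i). Qed.

Lemma hammingE u v : hamming u v = \sum_i (u i != v i).
Proof.
rewrite /hamming cardsE -sum1_card big_mkcond /=; apply: eq_bigr => i _.
by rewrite unfold_in; case: (u i != v i).
Qed.

Lemma hammingC u v : hamming u v = hamming v u.
Proof. by rewrite !hammingE; apply: eq_bigr => i _; rewrite eq_sym. Qed.

Lemma hamming_le u v : hamming u v <= n.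
Proof. by rewrite -[X in _ <= X]card_ord max_card. Qed.

Lemma hamming_eq0 u v : (hamming u v == 0) = (u == v).
Proof.
rewrite cards_eq0; apply/eqP/eqP => [/setP uv|->].
  by apply/ffunP => i; have := uv i; rewrite !inE => /negbFE/eqP.
by apply/setP => i; rewrite !inE eqxx.
Qed.

Lemma hamming_triangle v u w : hamming u w <= hamming u v + hamming v w.
Proof.
rewrite !hammingE -big_split /=; apply: leq_sum => i _.
by case: (u i) (v i) (w i) => [] [] [].
Qed.

Lemma hamming_antipode u v : hamming u (antipode v) = n - hamming u v.
Proof.
apply/eqP; rewrite -(eqn_add2r (hamming u v)) subnK ?hamming_le // !hammingE.
rewrite -big_split /= -[X in _ == X](card_ord n) -sum1_card; apply/eqP.
by apply: eq_bigr => i _; rewrite ffunE; case: (u i) (v i) => [] [].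
Qed.

Definition flip (i : 'I_n) u : cube n := [ffun j => u j (+) (j == i)].

Lemma flipK i : involutive (flip i).
Proof. by move=> u; apply/ffunP => j; rewrite !ffunE -addbA addbb addbF. Qed.

Lemma hamming_flip i u v : u i != v i -> hamming u v = (hamming (flip i u) v).+1.
Proof.
move=> neq; rewrite !hammingE (bigD1 i) //= [in RHS](bigD1 i) //= ffunE eqxx neq.
have -> : (u i (+) true != v i) = false by move: neq; case: (u i) (v i) => [] [].
congr (_.+1); apply: eq_bigr => j /negbTE neq_ji.
by rewrite ffunE neq_ji addbF.
Qed.

Definition fold_dist u v := minn (hamming u v) (n - hamming u v).

Lemma fold_dist_antipode u v : fold_dist u (antipode v) = fold_dist u v.
Proof. by rewrite /fold_dist hamming_antipode subKn ?hamming_le // minnC. Qed.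

Lemma fold_distC u v : fold_dist u v = fold_dist v u.
Proof. by rewrite /fold_dist hammingC. Qed.

Lemma fold_dist_eq0 u v : (fold_dist u v == 0) = (u == v) || (u == antipode v).
Proof.
by rewrite -!hamming_eq0 hamming_antipode /fold_dist; have := hamming_le u v; lia.
Qed.

Lemma fclass_proof u :
  [exists u' : cube n, [set u; antipode u] == [set u'; antipode u'] ].
Proof. by apply/existsP; exists u. Qed.

Definition fclass u : folded_vertex n :=
  exist (fun A : {set cube n} => [exists v, A == [set v; antipode v]]) _ (fclass_proof u).

Lemma mem_fclass u v : (v \in val (fclass u)) = (v == u) || (v == antipode u).
Proof. by rewrite !inE. Qed.

Lemma fclass_antipode u : fclass (antipode u) = fclass u.
Proof. by apply: val_inj; rewrite /= antipodeK finset.setUC. Qed.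

Lemma fclass_eq u v : (fclass u == fclass v) = (u == v) || (u == antipode v).
Proof.
apply/eqP/orP => [uv|[]/eqP->//]; last exact: fclass_antipode.
by apply/orP; rewrite -mem_fclass -uv mem_fclass eqxx.
Qed.

Lemma fclass_surj (A : folded_vertex n) : exists u, A == fclass u.
Proof. by have /existsP[u] := valP A; exists u. Qed.

Definition frepr (A : folded_vertex n) : cube n := xchoose (fclass_surj A).

Lemma freprK : cancel frepr fclass.
Proof. by move=> A; apply/esym/eqP/(xchooseP (fclass_surj A)). Qed.

Lemma folded_adjP (A B : folded_vertex n) :
  reflect (exists u v, [/\ A = fclass u, B = fclass v & hamming u v = 1]) (folded_adj A B).
Proof.
apply: (iffP existsP) => [[u /existsP[v /and3P[/eqP Au /eqP Bv]]]|[u [v [-> -> uv]]]].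
  have {Au} -> : A = fclass u by apply: val_inj.
  have {Bv} -> : B = fclass v by apply: val_inj.
  by case/orP => /eqP ?; exists u; [exists v|exists (antipode v); rewrite fclass_antipode].
by exists u; apply/existsP; exists v; rewrite uv !eqxx.
Qed.

Lemma fold_dist_fclass u v u' v' :
  fclass u = fclass u' -> fclass v = fclass v' -> fold_dist u v = fold_dist u' v'.
Proof.
have aux w x x' : fclass x = fclass x' -> fold_dist w x = fold_dist w x'.
  by move/eqP; rewrite fclass_eq => /orP[]/eqP-> //; rewrite fold_dist_antipode.
by move=> /(aux v) uu /(aux u') vv; rewrite fold_distC uu fold_distC.
Qed.

Lemma dist_fclass u v : dist (@folded_adj n) (fclass u) (fclass v) = fold_dist u v.
Proof.
rewrite (dist_eq (D := fun A B => fold_dist (frepr A) (frepr B))).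
- by apply: fold_dist_fclass; rewrite freprK.
- by move=> A B; rewrite fold_dist_eq0 -fclass_eq !freprK.
- move=> A B C /folded_adjP[x [y [-> -> xy]]]; set z := frepr C.
  have fE w : fold_dist (frepr (fclass w)) z = fold_dist w z.
    by apply: fold_dist_fclass; rewrite ?freprK.
  rewrite !fE.
  have := hamming_triangle y x z; have := hamming_triangle x y z.
  rewrite (hammingC y x) xy /fold_dist.
  by move: (hamming x z) (hamming y z) => a b; lia.
move=> A B; have [x /eqP->] := fclass_surj A; have [y /eqP->] := fclass_surj B.
have fE w w' : fold_dist (frepr (fclass w)) (frepr (fclass w')) = fold_dist w w'.
  by apply: fold_dist_fclass; rewrite freprK.
rewrite fE.
(* Replacing [y] by its antipode swaps [h] and [n - h]. Once [h] is the minimum, flipping a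
   coordinate where [x] and [y] differ moves one step closer. *)
wlog le_h : y / hamming x y <= n - hamming x y.
  move=> IH; have [|gt] := leqP (hamming x y) (n - hamming x y); first exact: IH.
  rewrite -(fold_dist_antipode x y) -(fclass_antipode y); apply: IH.
  by rewrite hamming_antipode; lia.
move=> d_gt0; have [i] : exists i, x i != y i.
  apply/existsP; apply: contraLR d_gt0; rewrite negb_exists -leqNgt leqn0 => /forallP xy.
  rewrite fold_dist_eq0; apply/orP; left; apply/eqP/ffunP => i.
  by apply/eqP; rewrite -[_ == _]negbK xy.
move=> xyi; exists (fclass (flip i x)).
  apply/folded_adjP; exists x, (flip i x); split=> //.
  rewrite (hamming_flip (i := i)); last by rewrite ffunE eqxx; case: (x i).
  by congr (_.+1); apply/eqP; rewrite hamming_eq0.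
rewrite fE.
by move: le_h; rewrite /fold_dist (hamming_flip xyi); lia.
Qed.

End Hamming.

(** * Detecting matrices *)

(** Indexed families, possibly with repetitions, allow [option] and product index types to be
    counted directly. *)
Definition fold_resolving n (J : finType) (y : J -> cube n) : Prop :=
  forall u v, (forall j, fold_dist u (y j) = fold_dist v (y j)) ->
  (u == v) || (u == antipode v).

Lemma beta_folded_le n (J : finType) (y : J -> cube n) :
  fold_resolving y -> beta_folded n <= #|J|.
Proof.
move=> yP; apply: leq_trans (leq_imset_card (fun j => fclass (y j)) J).
apply: metric_dim_le; apply/forallP => A; apply/forallP => B; apply/implyP.
have [u /eqP->] := fclass_surj A; have [v /eqP->] := fclass_surj B.
rewrite fclass_eq; apply: contraR; rewrite negb_exists => /forallP dP.
apply: yP => j; apply/eqP; move: (dP (fclass (y j))).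
by rewrite !dist_fclass (imset_f (fun j => fclass (y j))) //= negbK.
Qed.

Lemma beta_folded_witness n :
  exists y : 'I_(beta_folded n) -> cube n, fold_resolving y.
Proof.
rewrite /beta_folded; have [S /forallP resS <-] := metric_dim_witness (@folded_adj n).
exists (fun i => frepr (enum_val i)) => u v uvP; rewrite -fclass_eq.
have /forallP/(_ (fclass v)) := resS (fclass u); apply: contraLR => ->.
rewrite negb_exists; apply/forallP => A; rewrite negb_and.
case: (boolP (A \in S)) => //= AS.
rewrite negbK -(freprK A) !dist_fclass.
by have := uvP (enum_rank_in AS A); rewrite enum_rankK_in // => ->.
Qed.

(** Nonadaptive coin weighing: each row weighs a subset of the coins, and the results together must
    identify the set [x] of heavy ones. *)
Definition detecting (I J : finType) (A : J -> I -> bool) : Prop :=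
  forall x x' : I -> bool,
    (forall j, \sum_i (A j i && x i) = \sum_i (A j i && x' i)) -> x =1 x'.

Definition detectable (m n : nat) : Prop :=
  exists A : 'I_m -> 'I_n -> bool, detecting A.

(** A vector on [I'], extended by [false] off the image of [f], keeps its row sums. *)
Lemma detecting_sub (I I' J J' : finType) (f : I' -> I) (g : J' -> J)
    (A : J -> I -> bool) :
    injective f -> (forall j, exists j', g j' = j) -> detecting A ->
  detecting (fun j i => A (g j) (f i)).
Proof.
move=> f_inj g_surj dA x x' xx'.
pose ext (z : I' -> bool) i := [exists i', (f i' == i) && z i'].
have extf z i' : ext z (f i') = z i'.
  apply/existsP/idP => [[k /andP[/eqP/f_inj->]]//|zi]; by exists i'; rewrite eqxx.
have sum_ext z j : \sum_i (A j i && ext z i) = \sum_i' (A j (f i') && z i').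
  rewrite (bigID (mem [set f i' | i' in predT])) /= [X in _ + X]big1 ?addn0 => [|i Nf].
    by rewrite big_imset => [|? ? _ _ /f_inj//]; apply: eq_bigr => i' _; rewrite extf.
  suff -> : ext z i = false by rewrite andbF.
  by apply: contraNF Nf => /existsP[i' /andP[/eqP <- _]]; apply: imset_f.
have xx : ext x =1 ext x'.
  by apply: dA => j; have [j' <-] := g_surj j; rewrite !sum_ext xx'.
by move=> i; rewrite -extf xx extf.
Qed.

Lemma detectable_card (I J : finType) (A : J -> I -> bool) n :
  n <= #|I| -> detecting A -> detectable #|J| n.
Proof.
move=> le_nI dA; exists (fun j i => A (enum_val j) (enum_val (widen_ord le_nI i))).
apply: (detecting_sub (g := enum_val) _ _ dA) => [i i' /enum_val_inj/(congr1 val)/= ii'|j].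
  exact: val_inj.
by exists (enum_rank j); rewrite enum_rankK.
Qed.

Lemma detectable_leq m n n' : n' <= n -> detectable m n -> detectable m n'.
Proof.
by move=> le_n [A dA]; rewrite -(card_ord m); apply: detectable_card dA; rewrite card_ord.
Qed.

Lemma detectable_add m1 n1 m2 n2 :
  detectable m1 n1 -> detectable m2 n2 -> detectable (m1 + m2) (n1 + n2).
Proof.
move=> [A1 dA1] [A2 dA2].
pose A (j : 'I_m1 + 'I_m2) (i : 'I_n1 + 'I_n2) :=
  match j, i with
  | inl j, inl i => A1 j i
  | inr j, inr i => A2 j i
  | _, _ => false
  end.
rewrite -(card_ord m1) -(card_ord m2) -card_sum.
apply: (@detectable_card _ _ A); first by rewrite card_sum !card_ord.
move=> x x' xx'.
have x1 : x \o inl =1 x' \o inl.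
  apply: dA1 => j; have := xx' (inl j).
  by rewrite !big_sumType /= !sum_nat_const !muln0 !addn0.
have x2 : x \o inr =1 x' \o inr.
  apply: dA2 => j; have := xx' (inr j).
  by rewrite !big_sumType /= !sum_nat_const !muln0 !add0n.
by case=> i; [apply: x1 | apply: x2].
Qed.

Lemma detectable_mul q m n : detectable m n -> detectable (q * m) (q * n).
Proof.
move=> dmn; elim: q => [|q IHq]; last by rewrite !mulSn; apply: detectable_add.
by exists (fun _ _ => false) => x x' _ [].
Qed.

(* The query sets are (A_j, A_j, e_j), (A_j, ~ A_j, 0) and (0, 1, 0). Adding the *)
(* answers of the first two and subtracting that of the third leaves             *)
(* 2 <A_j, x1> + z_j, whose parity reveals the bit z_j.                          *)
Lemma detectable_double m n :
  detectable m n -> detectable (m + m + 1) (n + n + m).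
Proof.
move=> [A dA].
pose B (j : 'I_m + 'I_m + unit) (i : 'I_n + 'I_n + 'I_m) :=
  match j, i with
  | inl (inl j), inl (inl i) => A j i
  | inl (inl j), inl (inr i) => A j i
  | inl (inl j), inr k => k == j
  | inl (inr j), inl (inl i) => A j i
  | inl (inr j), inl (inr i) => ~~ A j i
  | inr _, inl (inr i) => true
  | _, _ => false
  end.
have -> : m + m + 1 = #|{: 'I_m + 'I_m + unit}| by rewrite !card_sum !card_ord card_unit.
apply: (@detectable_card _ _ B); first by rewrite !card_sum !card_ord.
move=> x x' xx'.
pose p (y : 'I_n + 'I_n + 'I_m -> bool) j := \sum_i (A j i && y (inl (inl i))).
pose q (y : 'I_n + 'I_n + 'I_m -> bool) j := \sum_i (A j i && y (inl (inr i))).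
pose t (y : 'I_n + 'I_n + 'I_m -> bool) := \sum_i (y (inl (inr i)) : nat).
have B1 y j : \sum_i (B (inl (inl j)) i && y i) = p y j + q y j + y (inr j).
  rewrite !big_sumType /=; congr (_ + _); rewrite (bigD1 j) //= eqxx big1 ?addn0 // => k.
  by move/negbTE->.
have B2 y j : \sum_i (B (inl (inr j)) i && y i) + q y j = p y j + t y.
  rewrite !big_sumType /= sum_nat_const muln0 addn0 -addnA -big_split /=; congr (_ + _).
  by apply: eq_bigr => i _; case: (A j i) (y _) => [] [].
have B3 y : \sum_i (B (inr tt) i && y i) = t y.
  by rewrite !big_sumType /= !sum_nat_const !muln0 addn0.
have pqz j : [/\ p x j = p x' j, q x j = q x' j & x (inr j) = x' (inr j)].
  have := B1 x j; have := B2 x j; have := B1 x' j; have := B2 x' j.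
  have := B3 x; have := B3 x'; rewrite !xx'.
  by case: (x (inr j)) (x' (inr j)) => [] []; split; lia.
case=> [[]|] i; last by case: (pqz i).
- by apply: (dA (x \o inl \o inl) (x' \o inl \o inl)) => j; case: (pqz j).
- by apply: (dA (x \o inl \o inr) (x' \o inl \o inr)) => j; case: (pqz j).
Qed.

(** Iterated doubling from the one-by-one matrix; the number of columns per row grows like
    [k / 2]. *)
Lemma detectable_expn k : detectable (2 ^ k.+1).-1 (k * 2 ^ k).+1.
Proof.
elim: k => [|k /detectable_double].
  exists (fun _ _ => true) => x x' /(_ ord0); rewrite !big_ord1 /= => xx' i.
  by rewrite ord1; case: (x ord0) (x' ord0) xx' => [] [].
suff [-> ->] : (2 ^ k.+1).-1 + (2 ^ k.+1).-1 + 1 = (2 ^ k.+2).-1 /\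
  (k * 2 ^ k).+1 + (k * 2 ^ k).+1 + (2 ^ k.+1).-1 = (k.+1 * 2 ^ k.+1).+1 by [].
by rewrite !expnS; have := expn_gt0 2 k; lia.
Qed.

Lemma detectable_exists k n : 0 < k ->
  exists2 m, detectable m n & m <= (n %/ (k * 2 ^ k)).+1 * 2 ^ k.+1.
Proof.
move=> k_gt0; set q := (n %/ _).+1; exists (q * (2 ^ k.+1).-1).
  apply: detectable_leq (detectable_mul q (detectable_expn k)).
  have : n < q * (k * 2 ^ k) by apply: ltn_ceil; rewrite muln_gt0 k_gt0 expn_gt0.
  by move/ltnW/leq_trans; apply; rewrite leq_mul2l leqnSn orbT.
by rewrite leq_mul2l leq_pred orbT.
Qed.

(** * From detecting matrices to resolving sets *)

Definition cube_resolving n (J : finType) (y : J -> cube n) : Prop :=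
  forall u v, (forall j, hamming u (y j) = hamming v (y j)) -> u = v.

(** With [|w|] the number of ones, [h(w, a) = |w| + |a| - 2 <a, w>]; the extra index [None] carries
    the zero vertex, which supplies [|w|]. *)
Lemma cube_resolving_exists m n :
  detectable m n -> exists y : option 'I_m -> cube n, cube_resolving y.
Proof.
move=> [A dA].
exists (fun j => if j is Some j then [ffun i => A j i] else [ffun=> false]) => u v uv.
apply/ffunP; apply: (dA u v) => j.
have ham (w a : cube n) :
    hamming w a + (\sum_i (a i && w i)).*2 = hamming w [ffun=> false] + \sum_i a i.
  rewrite -mul2n !hammingE big_distrr -!big_split /=; apply: eq_bigr => i _.
  by rewrite ffunE; case: (w i) (a i) => [] [].
have rowE w : \sum_i ([ffun i => A j i] i && w i) = \sum_i (A j i && w i).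
  by apply: eq_bigr => i _; rewrite ffunE.
have := ham u [ffun i => A j i]; rewrite (uv (Some j)) (uv None) -ham !rowE.
by move/addnI/double_inj.
Qed.

Lemma odd_hamming n (u v w : cube n) :
  odd (hamming u v) = odd (hamming u w) (+) odd (hamming v w).
Proof.
rewrite !hammingE -oddD -big_split /= !(big_morph odd oddD (erefl _)) /=.
by apply: eq_bigr => i _; case: (u i) (v i) (w i) => [] [] [].
Qed.

(* For odd n the two candidates d and n - d for a Hamming distance have different *)
(* parities, and the parity can be prescribed by the choice of u or its antipode. *)
Lemma odd_fold_resolving n (J : finType) (y : J -> cube n) :
  odd n -> cube_resolving y -> fold_resolving y.
Proof.
move=> n_odd yP.
have even_case u v : ~~ odd (hamming u v) ->
    (forall j, fold_dist u (y j) = fold_dist v (y j)) -> u = v.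
  move=> uv_even uvP; apply: yP => j; move: (uvP j) uv_even.
  rewrite (odd_hamming u v (y j)) /fold_dist.
  have := hamming_le u (y j); have := hamming_le v (y j); lia.
move=> u v uvP; have [odd_uv|even_uv] := boolP (odd (hamming u v)); last first.
  by rewrite (even_case u v) ?eqxx.
apply/orP; right; apply/eqP/even_case => [|j].
  by rewrite hamming_antipode oddB ?hamming_le // n_odd odd_uv.
by rewrite uvP fold_distC -fold_dist_antipode fold_distC.
Qed.

Definition set_coord n (i0 : 'I_n) (b : bool) (u : cube n) : cube n :=
  [ffun i => if i == i0 then b else u i].

(* Moving y_i0 away from u_i0 changes the distance d to d + 1, so the change of *)
(* min(d, n - d) tells on which side of n / 2 the distance d lies.               *)
Lemma pair_fold_resolving n (i0 : 'I_n) (J : finType) (y : J -> cube n) :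
    cube_resolving y ->
  fold_resolving (fun jb : J * bool => set_coord i0 jb.2 (y jb.1)).
Proof.
move=> yP.
pose h (u w : cube n) := \sum_(i | i != i0) (u i != w i).
have hamE u w : hamming u w = (u i0 != w i0) + h u w by rewrite hammingE (bigD1 i0).
have hamS u w b : hamming u (set_coord i0 b w) = (u i0 != b) + h u w.
  rewrite hamE ffunE eqxx; congr (_ + _); apply: eq_bigr => i /negbTE ii0.
  by rewrite ffunE ii0.
have same (u v : cube n) : u i0 = v i0 ->
    (forall jb : J * bool, fold_dist u (set_coord i0 jb.2 (y jb.1)) =
                           fold_dist v (set_coord i0 jb.2 (y jb.1))) -> u = v.
  move=> uvi0 uvP; apply: yP => j; rewrite !hamE -uvi0; congr (_ + _).
  have := uvP (j, u i0); have := uvP (j, ~~ u i0); rewrite /fold_dist !hamS /= -uvi0.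
  have -> : (u i0 != ~~ u i0) = true by case: (u i0).
  rewrite eqxx; have := hamming_le u (set_coord i0 (~~ u i0) (y j)).
  have := hamming_le v (set_coord i0 (~~ u i0) (y j)); rewrite !hamS -uvi0.
  have -> : (u i0 != ~~ u i0) = true by case: (u i0).
  by lia.
move=> u v uvP; have [uv|uv] := eqVneq (u i0) (v i0); first by rewrite (same u v) ?eqxx.
rewrite (same u (antipode v)) ?eqxx ?orbT //.
  by rewrite ffunE; case: (u i0) (v i0) uv => [] [].
by move=> jb; rewrite uvP fold_distC -fold_dist_antipode fold_distC.
Qed.

Lemma beta_folded_odd_le k n : odd n -> 0 < k ->
  beta_folded n <= ((n %/ (k * 2 ^ k)).+1 * 2 ^ k.+1).+1.
Proof.
move=> n_odd /(detectable_exists n)[m /cube_resolving_exists[y yP] le_m].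
apply: leq_trans (beta_folded_le (odd_fold_resolving n_odd yP)) _.
by rewrite card_option card_ord.
Qed.

Lemma beta_folded_le2 k n : 0 < n -> 0 < k ->
  beta_folded n <= 2 * ((n %/ (k * 2 ^ k)).+1 * 2 ^ k.+1).+1.
Proof.
move=> n_gt0 /(detectable_exists n)[m /cube_resolving_exists[y yP] le_m].
apply: leq_trans (beta_folded_le (pair_fold_resolving (i0 := Ordinal n_gt0) yP)) _.
by rewrite card_prod card_option card_ord card_bool mulnC leq_mul2l.
Qed.

(** * The counting bound *)

Section SecondMoment.
Variables (n : nat) (y : cube n).
Local Open Scope ring_scope.

Let sg (i : 'I_n) (u : cube n) : int := (-1) ^+ (u i != y i).

Lemma hamming_sign_sum u : n%:Z - 2 * (hamming u y)%:Z = \sum_i sg i u.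
Proof.
rewrite hammingE -[in n%:Z](card_ord n) -sum1_card !(big_morph Posz PoszD (erefl _)).
rewrite mulr_sumr -sumrB; apply: eq_bigr => i _; rewrite /sg.
by case: (u i != y i).
Qed.

(** The signs [sg i] are orthogonal over the cube, so only the diagonal terms of the expanded square
    survive. *)
Lemma sum_sqr_hamming : \sum_u (n%:Z - 2 * (hamming u y)%:Z) ^+ 2 = n%:Z * 2 ^+ n.
Proof.
under eq_bigr do rewrite hamming_sign_sum expr2 mulr_suml.
rewrite exchange_big /=.
have orth i : \sum_u sg i u * (\sum_j sg j u) = 2 ^+ n.
  under eq_bigr do rewrite mulr_sumr.
  rewrite exchange_big /= (bigD1 i) //= [X in _ + X]big1 => [|j ji].
    rewrite addr0 (eq_bigr (fun=> 1)) => [|u _]; last by rewrite /sg; case: (_ != _).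
    by rewrite sumr_const card_ffun card_bool card_ord -natrX natz.
  (* Flipping coordinate [i] negates [sg i] and fixes [sg j], so the cross term equals its own
     negative. *)
  set S := \sum_u _; suff : S = - S by lia.
  rewrite /S -sumrN [LHS](reindex_inj (inv_inj (flipK i))) /=; apply: eq_bigr => u _.
  rewrite /sg !ffunE eqxx (negbTE ji) addbF -mulNr; congr (_ * _).
  by case: (u i); case: (y i); rewrite /= ?expr0 ?expr1 ?opprK.
by rewrite (eq_bigr _ (fun i _ => orth i)) sumr_const card_ord -[LHS]mulr_natl natz.
Qed.

(** The summand is [a = |n - 2 h|]. Summing [2 s a <= a ^ 2 + s ^ 2] and using the second moment
    [n <= s ^ 2] bounds the mean by [s] without real square roots. *)
Lemma sum_deviation_le s : (0 < s -> n <= s ^ 2 ->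
  \sum_u (n - 2 * fold_dist u y) <= s * 2 ^ n)%N.
Proof.
move=> s_gt0 le_ns; pose a u := (n - 2 * fold_dist u y)%N.
have aE u : (a u)%:Z ^+ 2 = (n%:Z - 2 * (hamming u y)%:Z) ^+ 2.
  apply/eqP; rewrite eqf_sqr /a /fold_dist; have := hamming_le u y; lia.
have amgm : \sum_u (2 * s%:Z * (a u)%:Z) <= \sum_u ((a u)%:Z ^+ 2 + s%:Z ^+ 2).
  apply: ler_sum => u _; rewrite -subr_ge0.
  by rewrite (_ : _ - _ = ((a u)%:Z - s%:Z) ^+ 2) ?sqr_ge0 //; ring.
move: amgm; rewrite -mulr_sumr big_split /= (eq_bigr _ (fun u _ => aE u)) sum_sqr_hamming.
rewrite sumr_const card_ffun card_bool card_ord -(big_morph Posz PoszD (erefl _)).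
move: (\sum_u a u)%N => S; rewrite -[_ *+ (2 ^ n)]mulr_natr -natrX natz.
move: (2 ^ n)%N le_ns => N; rewrite expr2 expnS expn1; nia.
Qed.

End SecondMoment.

Section Counting.
Local Open Scope ring_scope.

Lemma sum_half_pow_le s N : (0 < s)%N ->
  \sum_(a < N) (2^-1 : rat) ^+ (a %/ s) <= 2 * s%:R.
Proof.
move=> s_gt0.
(* Each exponent occurs [s] times in a row, so complete blocks form a geometric series. *)
have block M : \sum_(a < s * M) (2^-1 : rat) ^+ (a %/ s) = 2 * s%:R * (1 - 2^-1 ^+ M).
  elim: M => [|M IHM]; first by rewrite muln0 big_ord0 expr0 subrr mulr0.
  rewrite mulnS addnC big_split_ord /= IHM.
  rewrite [X in _ + X](eq_bigr (fun=> 2^-1 ^+ M)) => [|i _].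
    by rewrite sumr_const card_ord -mulr_natl exprS; field.
  by rewrite mulnC divnMDl // divn_small ?addn0.
have le_N : (N <= s * N)%N by rewrite leq_pmull.
apply: (@le_trans _ _ (\sum_(a < s * N) (2^-1 : rat) ^+ (a %/ s))).
  by rewrite -(subnKC le_N) big_split_ord /= lerDl sumr_ge0.
by rewrite block ler_piMr ?mulr_ge0 ?ler0n // lerBlDr lerDl exprn_ge0.
Qed.

(** Replaces Jensen's inequality: averaged over an [X] of mean at most [k], it gives [2 ^ - X] a
    mean of at least [2 ^ - k]. *)
Lemma half_pow_tangent (k X : nat) :
  (1 + k%:R - X%:R : rat) <= 2 ^+ k * 2^-1 ^+ X.
Proof.
have [le_Xk|lt_kX] := leqP X k.
  rewrite -(subnK le_Xk) exprD -mulrA -exprMn divff // expr1n mulr1.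
  by rewrite natrD addrA addrK -natrX nat1r ler_nat; apply: ltn_expl.
apply: (@le_trans _ _ 0); last by rewrite mulr_ge0 ?exprn_ge0.
by rewrite subr_le0 addrC natr1 ler_nat.
Qed.

Lemma fold_resolving_card n (J : finType) (y : J -> cube n) s :
    (0 < s)%N -> (n <= s ^ 2)%N -> fold_resolving y ->
  (2 ^ n <= 2 * (4 * s) ^ #|J|)%N.
Proof.
move=> s_gt0 le_ns yP; set k := #|J|.
pose a u j := (n - 2 * fold_dist u (y j))%N.
pose X u := (\sum_j a u j %/ s)%N.
have sumX : (\sum_u X u <= k * 2 ^ n)%N.
  rewrite exchange_big /= -sum_nat_const; apply: leq_sum => j _.
  rewrite -(leq_pmul2l s_gt0) big_distrr /=.
  apply: leq_trans (sum_deviation_le (y j) s_gt0 le_ns).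
  by apply: leq_sum => u _; rewrite mulnC leq_trunc_div.
(* The weight [2 ^ - X] factors over [j], so its sum over all conceivable profiles [f] is a product
   of one-variable sums. *)
pose G (f : {ffun J -> 'I_n.+1}) : rat := \prod_j 2^-1 ^+ (f j %/ s).
pose phi u : {ffun J -> 'I_n.+1} := [ffun j => inord (a u j)].
have phiE u j : phi u j = a u j :> nat by rewrite ffunE inordK // ltnS leq_subr.
have GX u : G (phi u) = 2^-1 ^+ X u.
  by rewrite /G expr_sum; apply: eq_bigr => j _; rewrite phiE.
have G_ge0 f : 0 <= G f by apply: prodr_ge0 => j _; rewrite exprn_ge0.
(* As [fold_dist] is at most [n / 2], truncated subtraction loses nothing: a profile fixes all
   distances, hence an antipodal pair. *)
have fibre f : (#|[pred u | phi u == f]| <= 2)%N.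
  case: (pickP [pred u | phi u == f]) => [u /eqP uf|/eq_card0-> //].
  apply: leq_trans (_ : #|[set u; antipode u]| <= 2)%N; last first.
    by rewrite cards2; case: (_ != _).
  apply/subset_leq_card/fintype.subsetP => v; rewrite !inE => /eqP vf.
  apply: yP => j; have := phiE u j; rewrite uf -vf phiE /a /fold_dist.
  have := hamming_le u (y j); have := hamming_le v (y j); lia.
have upper : \sum_u 2^-1 ^+ X u <= 2 * (2 * s%:R) ^+ k :> rat.
  rewrite (eq_bigr _ (fun u _ => esym (GX u))) (partition_big phi xpredT) //=.
  apply: (@le_trans _ _ (\sum_f 2 * G f)).
    apply: ler_sum => f _; rewrite (eq_bigr (fun=> G f)) => [|u /eqP->//].
    by rewrite sumr_const -[G f *+ _]mulr_natl ler_wpM2r // ler_nat fibre.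
  rewrite -mulr_sumr ler_wpM2l //.
  rewrite -(bigA_distr_bigA (fun _ (b : 'I_n.+1) => 2^-1 ^+ (b %/ s))) /=.
  rewrite -/k -prodr_const; apply: ler_prod => j _.
  by rewrite sumr_ge0 ?sum_half_pow_le.
have lower : (2 ^ n)%:R <= 2 ^+ k * \sum_u 2^-1 ^+ X u :> rat.
  rewrite mulr_sumr; apply: le_trans (ler_sum _ (fun u _ => half_pow_tangent k (X u))).
  rewrite sumrB sumr_const card_ffun card_bool card_ord -natr_sum -[(1 + _) *+ _]mulr_natr mulrDl mul1r.
  by rewrite -addrA lerDl subr_ge0 -natrM ler_nat.
rewrite -(ler_nat rat); apply: (le_trans lower).
apply: le_trans (ler_wpM2l _ upper) _; first by rewrite exprn_ge0.
by rewrite mulrCA -exprMn natrM natrX natrM mulrA -natrM.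
Qed.

Lemma beta_folded_card n s : (0 < s)%N -> (n <= s ^ 2)%N ->
  (2 ^ n <= 2 * (4 * s) ^ beta_folded n)%N.
Proof.
move=> s_gt0 le_ns; have [y /(fold_resolving_card s_gt0 le_ns)] := beta_folded_witness n.
by rewrite card_ord.
Qed.

End Counting.

(** * Asymptotics *)

Lemma nat_sqrt_exists l : exists r, r ^ 2 <= l < r.+1 ^ 2.
Proof.
elim: l => [|l [r /andP[le_rl lt_lr]]]; first by exists 0.
have [lt|ge] := ltnP l.+1 (r.+1 ^ 2); first by exists r; rewrite lt (leq_trans le_rl).
by exists r.+1; rewrite ge /= (leq_ltn_trans lt_lr) // ltn_sqr.
Qed.

Lemma cube_le_expn2 r : 10 <= r -> r ^ 3 <= 2 ^ r.
Proof.
elim: r => // x IHx; rewrite leq_eqVlt => /orP[/eqP <- //|]; rewrite ltnS => x_ge.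
have := IHx x_ge; rewrite [2 ^ _.+1]expnS; move: (2 ^ x) => P; rewrite !expnS expn0 !muln1.
have h1 : 10 * x <= x * x by rewrite leq_mul2r x_ge orbT.
have h2 : 10 * (x * x) <= x * (x * x) by rewrite leq_mul2r x_ge orbT.
lia.
Qed.

Lemma beta_folded_ge n : 0 < n ->
  2 * n <= 2 + (trunc_log 2 n + 6) * beta_folded n.
Proof.
(* With [s = 2 ^ t], [2 t > l] gives [n < s ^ 2], and [4 s = 2 ^ (t + 2)] turns the counting bound
   into [n <= 1 + (t + 2) b]. *)
move=> n_gt0; set l := trunc_log 2 n; set b := beta_folded n; pose t := l./2.+1.
have le_ns : n <= (2 ^ t) ^ 2.
  apply: ltnW; apply: leq_trans (trunc_log_ltn n (isT : 1 < 2)) _.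
  by rewrite -expnM leq_exp2l // /t; lia.
have := beta_folded_card (expn_gt0 2 t) le_ns; rewrite -/b.
rewrite -[4]/(2 ^ 2) -expnD -expnM -expnS leq_exp2l // /t => le_n.
have : 2 * (l./2 + 3) * b <= (l + 6) * b by rewrite leq_mul2r; apply/orP; right; lia.
lia.
Qed.

Section Estimates.
Variables (n r : nat).
Let l := trunc_log 2 n.
Hypotheses (n_gt0 : 0 < n) (r_le : r ^ 2 <= l).

Lemma beta_folded_lower : 2 * n * r <= r * (beta_folded n * l) + 14 * n.
Proof.
have := beta_folded_ge n_gt0; rewrite -/l; move: (beta_folded n) => b hb.
have le_rl : r <= l.
  by apply: leq_trans r_le; rewrite -mulnn; case: (r) => // r'; rewrite leq_pmull.
have le_ln : l <= n.
  by apply: leq_trans (trunc_logP (isT : 1 < 2) n_gt0); apply/ltnW/ltn_expl.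
have h1 : r * l * (2 * n) <= r * l * (2 + (l + 6) * b) by rewrite leq_mul2l hb orbT.
(* The constant is 14 = 12 + 2: [12 n r <= 12 n l] by [h2], and [2 r l <= 2 n l] by [h3]. *)
rewrite -(@leq_pmul2l (l + 6)) ?addn_gt0 ?orbT //.
have h2 : n * r <= n * l by rewrite leq_mul2l le_rl orbT.
have h3 : r * l <= n * l by rewrite leq_mul2r (leq_trans le_rl) ?orbT.
by move: h1 h2 h3; clearbody l => *; lia.
Qed.

Hypotheses (r_ge : 10 <= r) (r_lt : l < r.+1 ^ 2).

(* The block parameter k = l - r makes 2 ^ k at most n / 2 ^ r, hence negligible *)
(* against n / l, while k is still asymptotic to l.                              *)
Lemma block_bound b c :
    b <= c * ((n %/ ((l - r) * 2 ^ (l - r))).+1 * 2 ^ (l - r).+1).+1 ->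
  r * (b * l.+1) <= c * (n * (2 * r + 10)).
Proof.
set k := l - r; set P := 2 ^ r; set Q := 2 ^ k => hb.
have r10 : 10 * r <= r * r by rewrite leq_mul2r r_ge orbT.
have rr10 : 10 * (r * r) <= r * (r * r) by rewrite leq_mul2r r_ge orbT.
have le_rl : r < l by apply: leq_trans r_le; rewrite -mulnn; lia.
have k_gt0 : 0 < k by rewrite subn_gt0.
have kE : k + r = l by rewrite subnK // ltnW.
have PQ : P * Q <= n.
  by rewrite -expnD addnC kE; apply: trunc_logP.
have Q_gt0 : 0 < Q by rewrite expn_gt0.
have P_gt0 : 0 < P by rewrite expn_gt0.
have P_ge : r * r * r <= P.
  by have := cube_le_expn2 r_ge; rewrite !expnS expn0 muln1 mulnA.
(* That is, [b <= c n (2 / k + 3 / P)]: the quotient gives [2 / k], rounding it up gives [2 / P],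
   and the additional vertex at most [1 / P]. *)
have kPb : k * P * b <= c * (n * (2 * P + 3 * k)).
  have h1 : k * P * b <= k * P * (c * ((n %/ (k * Q)).+1 * (2 * Q)).+1).
    by rewrite leq_mul2l -expnS hb orbT.
  apply: (leq_trans h1).
  rewrite mulnCA leq_mul2l; apply/orP; right.
  have := leq_divM n (k * Q); move: (n %/ _) => q hq.
  have h2 : P * (q * (k * Q)) <= P * n by rewrite leq_mul2l hq orbT.
  have h3 : k * (P * Q) <= k * n by rewrite leq_mul2l PQ orbT.
  have h4 : k * P * 1 <= k * P * Q by rewrite leq_mul2l Q_gt0 orbT.
  by clear -h2 h3 h4; clearbody P Q k; lia.
rewrite -(@leq_pmul2l (k * P)) ?muln_gt0 ?k_gt0 //.
have h1 : r * l.+1 <= (r + 2) * k.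
  by move: r_le; rewrite -mulnn -kE; clearbody k; clear -r10; lia.
have h2 : r * l.+1 <= 2 * P.
  have := leq_mul (leqnn r) r_lt; rewrite -mulnn.
  by clearbody P l; clear -P_ge r10 rr10; lia.
(* The constant is 10 = 4 + 6: [h1] contributes [2 (r + 2)] and [h2] contributes [3 * 2]. *)
have h3 : r * l.+1 * (2 * P + 3 * k) <= (2 * r + 10) * (k * P).
  have := leq_mul (leqnn (2 * P)) h1; have := leq_mul (leqnn (3 * k)) h2.
  by clearbody P k l; clear; lia.
have h4 := leq_mul (leqnn (r * l.+1)) kPb.
have h5 := leq_mul (leqnn (c * n)) h3.
by clearbody P k l; clear -h4 h5; lia.
Qed.

Lemma beta_folded_odd_upper : odd n ->
  r * (beta_folded n * l.+1) <= n * (2 * r + 10).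
Proof.
move=> n_odd; rewrite -[X in _ <= X]mul1n; apply: block_bound.
rewrite mul1n; apply: beta_folded_odd_le => //.
by rewrite subn_gt0; apply: leq_trans r_le; rewrite -mulnn ltn_Pmull // (leq_trans _ r_ge).
Qed.

Lemma beta_folded_upper : r * (beta_folded n * l.+1) <= 2 * (n * (2 * r + 10)).
Proof.
apply: block_bound; apply: beta_folded_le2 => //.
by rewrite subn_gt0; apply: leq_trans r_le; rewrite -mulnn ltn_Pmull // (leq_trans _ r_ge).
Qed.

End Estimates.

Local Open Scope classical_set_scope.
Local Open Scope ring_scope.

Section Asymptotics.
Variable R : realType.

Lemma trunc_log_log2 (n : nat) : (0 < n)%N ->
  (trunc_log 2 n)%:R <= log2 (n%:R : R) <= (trunc_log 2 n).+1%:R.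
Proof.
move=> n_gt0; have ln2_gt0 : 0 < ln (2 : R) by rewrite ln_gt0 // ltr1n.
have lnX k : ln ((2 ^ k)%:R : R) = k%:R * ln 2 by rewrite natrX lnXn // mulr_natl.
rewrite /log2 ler_pdivlMr // ler_pdivrMr // -!lnX !ler_ln ?posrE ?ltr0n ?expn_gt0 //.
by rewrite !ler_nat trunc_logP //= ltnW // trunc_log_ltn.
Qed.

Definition beta_ratio (n : nat) : R := (beta_folded n)%:R / (n%:R / log2 n%:R).

Lemma beta_ratio_near (e : R) : 0 < e ->
  \forall n \near \oo,
    [/\ 0 < n%:R / log2 (n%:R : R), 2 - e <= beta_ratio n,
        odd n -> beta_ratio n <= 2 + e & beta_ratio n <= 4 + e].
Proof.
(* The errors to absorb are [14 / r] below and [10 / r], [20 / r] above, so [20 / r <= e] suffices;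
   [n >= 2 ^ (r0 ^ 2)] forces [r >= r0]. *)
move=> e_gt0; have := archi_boundP (ltW (divr_gt0 (ltr0n R 20) e_gt0)).
move: (Num.bound _) => r1 r1P; pose r0 := maxn 10 r1.
exists (2 ^ (r0 ^ 2))%N => // n /= le_n.
have n_gt0 : (0 < n)%N by apply: leq_trans le_n; rewrite expn_gt0.
have [r /andP[r_le r_lt]] := nat_sqrt_exists (trunc_log 2 n).
have le_r0 : (r0 <= r)%N.
  by rewrite -ltnS -ltn_sqr; apply: leq_ltn_trans r_lt; apply: trunc_log_max.
have r_ge : (10 <= r)%N by apply: leq_trans le_r0; apply: leq_maxl.
have r_gt0 : (0 : R) < r%:R by rewrite ltr0n (leq_trans _ r_ge).
have re : 20 / r%:R <= e.
  rewrite ler_pdivrMr // mulrC -ler_pdivrMr //; apply/ltW/(lt_le_trans r1P).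
  by rewrite ler_nat (leq_trans _ le_r0) // leq_maxr.
have l_gt0 : (0 < trunc_log 2 n)%N.
  by apply: leq_trans r_le; rewrite sqrn_gt0 (leq_trans _ r_ge).
have /andP[le_lL leL] := trunc_log_log2 n_gt0.
have L_gt0 : 0 < log2 (n%:R : R) by apply: lt_le_trans le_lL; rewrite ltr0n.
have nR_gt0 : (0 : R) < n%:R by rewrite ltr0n.
have ratioE : beta_ratio n = (beta_folded n)%:R * log2 n%:R / n%:R.
  by rewrite /beta_ratio invf_div mulrA.
have upper c : (r * (beta_folded n * (trunc_log 2 n).+1) <= c * (n * (2 * r + 10)))%N ->
    beta_ratio n <= c%:R * (2 + 10 / r%:R).
  move=> h; rewrite ratioE ler_pdivrMr // -(ler_pM2l r_gt0).
  apply: (@le_trans _ _ (r * (beta_folded n * (trunc_log 2 n).+1))%:R).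
    by rewrite !natrM ler_wpM2l // ?ler_wpM2l // ltW.
  apply: (@le_trans _ _ (c * (n * (2 * r + 10)))%:R); first by rewrite ler_nat.
  rewrite !natrM natrD natrM le_eqVlt; apply/orP; left; apply/eqP.
  by field; rewrite gt_eqF.
split.
- exact: divr_gt0.
- rewrite ratioE ler_pdivlMr // -(ler_pM2l r_gt0).
  apply: (@le_trans _ _ (r * (beta_folded n * trunc_log 2 n))%:R); last first.
    by rewrite !natrM ler_wpM2l ?ler_wpM2l // ltW.
  have := beta_folded_lower n_gt0 r_le; rewrite -(ler_nat R) natrD (natrM _ 14).
  rewrite -lerBlDr => /(le_trans _); apply; rewrite !natrM.
  move: re; rewrite ler_pdivrMr // => re.
  have : 20 * n%:R <= e * r%:R * n%:R by rewrite ler_pM2r.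
  nra.
- move=> n_odd; have := upper 1%N; rewrite mul1n mul1r => /(_ _)/le_trans; apply.
    exact: beta_folded_odd_upper.
  by rewrite lerD2l (le_trans _ re) // ler_pM2r ?invr_gt0 // ler_nat.
apply: le_trans (upper 2%N _) _; first exact: beta_folded_upper.
by rewrite mulrDr -natrM lerD2l mulrA -natrM.
Qed.

End Asymptotics.

Theorem theorem10 (R : realType) :
  (exists o : nat -> R,
     o n @[n --> \oo] --> (0 : R) /\
     \forall n \near \oo, odd n ->
       (beta_folded n)%:R = (2 + o n) * (n%:R / log2 (n%:R : R)))
  /\
  (exists o1 o2 : nat -> R,
     [/\ o1 n @[n --> \oo] --> (0 : R),
         o2 n @[n --> \oo] --> (0 : R) &
         \forall n \near \oo, ~~ odd n ->
           (2 + o1 n) * (n%:R / log2 (n%:R : R)) <= (beta_folded n)%:R /\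
           (beta_folded n)%:R <= (4 + o2 n) * (n%:R / log2 (n%:R : R))]).
Proof.
split.
  exists (fun n => if odd n then beta_ratio R n - 2 else 0); split.
    apply/cvgrPdist_le => e e_gt0; have [N _ hN] := beta_ratio_near e_gt0.
    exists N => // n /hN[_ lo up _].
    rewrite sub0r normrN; case: ifP => [/up{}up|_]; last by rewrite normr0 ltW.
    by rewrite ler_norml lerBlDl lerBrDl lo up.
  have [N _ hN] := beta_ratio_near (ltr01 : 0 < 1 :> R); exists N => // n /hN[pos _ _ _] ->.
  by rewrite addrC subrK divfK // gt_eqF.
(* For even [n] the ratio is only known to lie asymptotically in [[2, 4]]; clipping at 0 keeps just
   the excess beyond either end, which tends to 0. *)
exists (fun n => Num.min (beta_ratio R n - 2) 0), (fun n => Num.max (beta_ratio R n - 4) 0).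
split.
- apply/cvgrPdist_le => e e_gt0; have [N _ hN] := beta_ratio_near e_gt0.
  exists N => // n /hN[_ lo _ _]; rewrite sub0r normrN ler0_norm ?ge_min ?lexx ?orbT //.
  by rewrite lerNl le_min lerBrDl lo oppr_le0 ltW.
- apply/cvgrPdist_le => e e_gt0; have [N _ hN] := beta_ratio_near e_gt0.
  exists N => // n /hN[_ _ _ up]; rewrite sub0r normrN ger0_norm ?le_max ?lexx ?orbT //.
  by rewrite ge_max lerBlDl up ltW.
have [N _ hN] := beta_ratio_near (ltr01 : 0 < 1 :> R); exists N => // n /hN[pos _ _ _] _.
split.
  by rewrite -ler_pdivlMr // -/(beta_ratio R n) -lerBrDl ge_min lexx.
by rewrite -ler_pdivrMr // -/(beta_ratio R n) -lerBlDl le_max lexx.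
Qed.
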